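(* Let $\sigma$ be a 2-stack sortable permutation. Then there exists a sorting word for $\sigma$ satisfying Property $(P)$. In particular, in the sorting process that this word encodes, for every $i \in \{1,\dots,r\}$ (where $r$ is the number of right-to-left minima of $\sigma$) the elements in the stacks at time $t_i$ are exactly those of $\sigma^{(i)}$.
   Context: Sorting with two stacks. A permutation $\sigma=\sigma_1\cdots\sigma_n$ of $\{1,\dots,n\}$ is the input; stacks $H$ and $V$ are initially empty. Operation $\rho$ pushes the next input element on top of $H$; $\lambda$ transfers the topmost element of $H$ to the top of $V$; $\mu$ pops the topmost element of $V$ and appends it to the output. $\sigma$ is 2-stack sortable if some sequence of legal operations outputs $1\,2\cdots n$; such a sequence, as a word $w$ over $\{\rho,\lambda,\mu\}$, is called a sorting word for $\sigma$ (each letter occurs exactly $n$ times). The decorated word of $w$ is obtained by indexing each letter by the value of the element on which the operation acts, so each of $\rho_a,\lambda_a,\mu_a$ ($1\le a\le n$) occurs exactly once. Statements about occurrences of indexed letters ''in $w$'' refer to the decorated word. Right-to-left minima. $\sigma_k$ is a right-to-left minimum if there is no $j>k$ with $\sigma_j<\sigma_k$. Let $k_1<\dots<k_r$ be the indices of the right-to-left minima (so $\sigma_{k_1}=1$, $k_r=n$). Let $\sigma^{(i)}$ be the subword of $\sigma$ formed by the elements $\sigma_j$ with $j<k_i$ and $\sigma_j>\sigma_{k_i}$ (also regarded as the set of these elements). Time $t_i$ is the moment just before $\sigma_{k_i}$ is pushed onto $H$. Blocks. Any word of distinct integers factors uniquely as a concatenation $B_1\cdots B_s$ of nonempty factors with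 every element of $B_a$ larger than every element of $B_b$ for $a<b$, and with $s$ maximal; write $\ominus[B_1,\dots,B_s]$ (with $s=0$ for the empty word). Write $\sigma^{(i)}=\ominus[B^{(i)}_1,\dots,B^{(i)}_{s_i}]$ for this factorization of $\sigma^{(i)}$. For $1\le i<r$ let $A^{(i)}=\{\sigma_j \mid j<k_i,\ \sigma_j>\sigma_{k_{i+1}}\}$, and let $p^{(i)}$ be the index such that $B^{(i)}_{p^{(i)}}$ contains the smallest value of $A^{(i)}$ (convention: $p^{(i)}=0$ if $A^{(i)}=\emptyset$). Property $(P)$. A sorting word $w$ for $\sigma$ satisfies $(P_i)$ if: (i) $\rho_{\sigma_{k_i}}\lambda_{\sigma_{k_i}}\mu_{\sigma_{k_i}}$ is a factor (consecutive letters) of $w$; (ii) $\mu_{\sigma_j}$ appears before $\rho_{\sigma_{k_i}}$ for every $\sigma_j<\sigma_{k_i}$; (iii) every $\mu_{\sigma_\ell}$ with $\sigma_\ell\in B^{(i)}_j$ and $j\in\{p^{(i)}+1,\dots,s_i\}$ appears before $\rho_{\sigma_{k_i+1}}$, where $\sigma_{k_i+1}$ is the element immediately following $\sigma_{k_i}$ in $\sigma$ (this condition is void for $i=r$). $w$ satisfies $(P)$ if it satisfies $(P_i)$ for all $i\in\{1,\dots,r\}$. *)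

(* Defs.v *)
From HB Require Import structures.
From mathcomp Require Import all_boot.

Set Implicit Arguments.
Unset Strict Implicit.
Unset Printing Implicit Defensive.

(* Permutations of {1, ..., n} are words: sequences [s : seq nat] such that
   [perm_eq s (iota 1 n)].  Positions in sequences are counted from 0. *)

(** * Sorting with two stacks in series *)

Inductive letter := Rho | Lam | Mu.

Definition letter_eqb (a b : letter) : bool :=
  match a, b with
  | Rho, Rho | Lam, Lam | Mu, Mu => true
  | _, _ => false
  end.

Lemma letter_eqP : Equality.axiom letter_eqb.
Proof. by case; case; constructor. Qed.

HB.instance Definition _ := hasDecEq.Build letter letter_eqP.

(* The head of a list is the next input element, resp. the top of a stack;
   the output is listed in order of appearance. *)
Record state := State {
  input : seq nat;
  stackH : seq nat;
  stackV : seq nat;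
  output : seq nat
}.

Definition init (s : seq nat) : state := State s [::] [::] [::].

(* Returns the element acted upon and the new state; [None] if the operation
   is illegal. *)
Definition step (a : letter) (st : state) : option (nat * state) :=
  match a, st with
  | Rho, State (x :: inp) H V out => Some (x, State inp (x :: H) V out)
  | Lam, State inp (x :: H) V out => Some (x, State inp H (x :: V) out)
  | Mu, State inp H (x :: V) out => Some (x, State inp H V (rcons out x))
  | _, _ => None
  end.

(* Returns the decorated word together with the final state. *)
Fixpoint run (w : seq letter) (st : state) :
    option (seq (letter * nat) * state) :=
  if w is a :: w' then
    if step a st is Some (x, st1) then
      if run w' st1 is Some (d, st2) then Some ((a, x) :: d, st2) else None
    else None
  else Some ([::], st).

Definition final_state (s : seq nat) (w : seq letter) : option state :=
  omap snd (run w (init s)).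

Definition decorated (s : seq nat) (w : seq letter) : seq (letter * nat) :=
  if run w (init s) is Some (d, _) then d else [::].

Definition sorting_word (s : seq nat) (w : seq letter) : Prop :=
  final_state s w = Some (State [::] [::] [::] (iota 1 (size s))).

Definition two_stack_sortable (s : seq nat) : Prop :=
  exists w, sorting_word s w.

(* In the decorated word of a sorting word every indexed letter occurs once. *)
Definition before (d : seq (letter * nat)) (a b : letter * nat) : bool :=
  (b \in d) && (index a d < index b d).

(** * Right-to-left minima *)

Definition rl_minima (s : seq nat) : seq nat :=
  [seq k <- iota 0 (size s) | all (fun x => nth 0 s k <= x) (drop k.+1 s)].

(* The minima are numbered from 0: [pos_min s i] and [val_min s i] are
   $k_{i+1}$ and $\sigma_{k_{i+1}}$, for [i < size (rl_minima s)]. *)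
Definition pos_min (s : seq nat) (i : nat) : nat := nth 0 (rl_minima s) i.
Definition val_min (s : seq nat) (i : nat) : nat := nth 0 s (pos_min s i).

Definition sigma_sub (s : seq nat) (i : nat) : seq nat :=
  [seq x <- take (pos_min s i) s | val_min s i < x].

(* Meaningful for [i.+1 < size (rl_minima s)]. *)
Definition A_sub (s : seq nat) (i : nat) : seq nat :=
  [seq x <- take (pos_min s i) s | val_min s i.+1 < x].

(** * Blocks *)

Definition skew_factorization (u : seq nat) (Bs : seq (seq nat)) : Prop :=
  [/\ flatten Bs = u,
      [::] \notin Bs
    & pairwise (fun B C => allrel (fun b c => c < b) B C) Bs].

Definition skew_decomposition (u : seq nat) (Bs : seq (seq nat)) : Prop :=
  skew_factorization u Bs /\
  forall Cs, skew_factorization u Cs -> size Cs <= size Bs.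

(* Blocks are numbered from 1 here, 0 being the value for an empty [A]. *)
Definition p_index (A : seq nat) (Bs : seq (seq nat)) : nat :=
  if A is x :: A' then (find (fun B : seq nat => foldr minn x A' \in B) Bs).+1
  else 0.

(** * Property (P) *)

(* The existential quantifier over [Bs] is harmless: every word with distinct
   letters has exactly one [skew_decomposition]. *)
Definition property_P_at (s : seq nat) (w : seq letter) (i : nat) : Prop :=
  let d := decorated s w in
  let m := val_min s i in
  [/\ infix [:: (Rho, m); (Lam, m); (Mu, m)] d,
      forall x, x \in s -> x < m -> before d (Mu, x) (Rho, m)
    & i.+1 < size (rl_minima s) ->
      exists2 Bs, skew_decomposition (sigma_sub s i) Bs &
        forall j x, p_index (A_sub s i) Bs < j <= size Bs ->
          x \in nth [::] Bs j.-1 ->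
          before d (Mu, x) (Rho, nth 0 s (pos_min s i).+1)].

Definition property_P (s : seq nat) (w : seq letter) : Prop :=
  forall i, i < size (rl_minima s) -> property_P_at s w i.

(* The state just before the [i]-th minimum is pushed onto the first stack. *)
Definition state_at_min (s : seq nat) (w : seq letter) (i : nat) :
    option state :=
  final_state s (take (index (Rho, val_min s i) (decorated s w)) w).

(* Main.v *)
Require Import Defs.
From mathcomp Require Import all_boot.

Set Implicit Arguments.
Unset Strict Implicit.
Unset Printing Implicit Defensive.

Implicit Types (I H V o s t u : seq nat) (m q x y : nat).

(** Why every sortable permutation has such a sorting word.

    Take any state from which sorting can be completed, and let [m] be a
    right-to-left minimum that has just been pushed, so that everything still
    to come is larger than [m].  Nothing larger than [m] may cover an element
    of [V] that is at most [m], since the output is increasing.  Hence, until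
    [m] is output, the completing word acts on the elements below [m] and, in
    between, on larger newcomers, and the two groups do not interact: the
    newcomers stay on top of [H], or go to [V] when no small element is there.  All operations on small elements can therefore be carried out
    first, before [m] enters, then [m] crosses both stacks at once, and the
    rest of the word still works ([drain_before_min_in_H],
    [drain_before_min_in_V]).

    The same commutation applies after [m] is output: if the elements smaller
    than some threshold [q] occupy the tops of both stacks, and the rest of
    the stacks and all of the remaining input is at least [q], then the small
    elements can be output at once ([drain_small]).  In [V] small elements
    are always on top; in [H] they are on top when they arrived last.  This is
    the situation of the trailing blocks of the word $\sigma^{(i)}$ beyond the
    block of the smallest element of $A^{(i)}$: they are smaller than the
    other blocks, come after them, and lie below the next right-to-left
    minimum, hence below the whole remaining input ([skew_tail_flushable],
    [tail_below_A]).

    Reading the permutation from left to right and applying both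
    normalizations at every right-to-left minimum, while keeping the current
    state completable, yields the word ([checkpointed_prefix]).  It passes
    through prescribed states at each minimum, and Property (P) is read off
    from those states: an element already output when [y] is still in the
    input has its [Mu] before the [Rho] of [y] ([mu_before_rho]). *)

(** * States from which sorting can be completed *)

(** The arguments are the components of a state.  The final output is only
    required to be increasing, so that statements about intermediate states
    need not refer to the permutation that was sorted. *)
Inductive sortable : seq nat -> seq nat -> seq nat -> seq nat -> Prop :=
| Sortable_done o : sorted ltn o -> sortable [::] [::] [::] o
| Sortable_rho x I H V o : sortable I (x :: H) V o -> sortable (x :: I) H V o
| Sortable_lam x I H V o : sortable I H (x :: V) o -> sortable I (x :: H) V o
| Sortable_mu x I H V o : sortable I H V (rcons o x) -> sortable I H (x :: V) o.

Lemma run_sortable W I H V o d o' :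
  run W (State I H V o) = Some (d, State [::] [::] [::] o') ->
  sorted ltn o' -> sortable I H V o.
Proof.
move=> + o'_sorted; elim: W I H V o d => [|a W IHW] I H V o d /=.
  by case=> _ -> -> -> ->; apply: Sortable_done.
case: a; [case: I => // x I | case: H => // x H | case: V => // x V];
  rewrite /=; case run_W: run => [[d' st]|//] [_ st_eq];
  rewrite st_eq in run_W; constructor; exact: IHW run_W.
Qed.

Lemma sortable_run I H V o : sortable I H V o ->
  exists W d o',
    run W (State I H V o) = Some (d, State [::] [::] [::] o') /\ sorted ltn o'.
Proof.
elim=> {I H V o} [o o_sorted | x I H V o _ | x I H V o _ | x I H V o _].
- by exists [::], [::], o.
- case=> W [d [o' [run_W ?]]].
  by exists (Rho :: W), ((Rho, x) :: d), o'; rewrite /= run_W.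
- case=> W [d [o' [run_W ?]]].
  by exists (Lam :: W), ((Lam, x) :: d), o'; rewrite /= run_W.
- case=> W [d [o' [run_W ?]]].
  by exists (Mu :: W), ((Mu, x) :: d), o'; rewrite /= run_W.
Qed.

(** The word [t] is what remains to be output.  Elements of [V] leave it from
    top to bottom whatever is put over them meanwhile, which makes [V] a
    subword of [t] and hence increasing from top to bottom. *)
Lemma sortable_future_output I H V o : sortable I H V o ->
  exists t, [/\ perm_eq t (I ++ H ++ V), sorted ltn (o ++ t) & subseq V t].
Proof.
elim=> {I H V o} [o o_sorted | x I H V o _ | x I H V o _ | x I H V o _].
- by exists [::]; split; rewrite ?perm_refl ?cats0.
- case=> t [t_perm t_sorted V_t]; exists t; split=> //.
  by apply: (perm_trans t_perm); rewrite -[x :: H]cat1s -[x :: I]cat1s -!catA perm_catCA.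
- case=> t [t_perm t_sorted V_t]; exists t; split=> //.
    apply: (perm_trans t_perm); rewrite perm_cat2l.
    by rewrite -[x :: H]cat1s -[x :: V]cat1s -catA perm_catCA.
  by apply: subseq_trans V_t; apply: subseq_cons.
- case=> t [t_perm t_sorted V_t]; exists (x :: t); split=> //.
  + rewrite -(perm_cons x) in t_perm; apply: (perm_trans t_perm).
    by rewrite -cat1s -[x :: V]cat1s !catA perm_cat2r -catA perm_catC.
  + by rewrite -cat_rcons.
  + by rewrite /= eqxx.
Qed.

Lemma sortable_stackV I H V o : sortable I H V o -> pairwise ltn V.
Proof.
case/sortable_future_output=> t [_ + V_t].
rewrite (sorted_pairwise ltn_trans) pairwise_cat => /and3P[_ _].
exact: subseq_pairwise.
Qed.

Lemma sortable_output_lt I H V o x y :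
  sortable I H V o -> x \in o -> y \in I ++ H ++ V -> x < y.
Proof.
case/sortable_future_output=> t [t_perm + _].
rewrite (sorted_pairwise ltn_trans) pairwise_cat => /and3P[/allrelP o_lt_t _ _].
by rewrite -(perm_mem t_perm); exact: o_lt_t.
Qed.

Lemma sortable_uniq I H V o : sortable I H V o -> uniq (I ++ H ++ V).
Proof.
case/sortable_future_output=> t [/perm_uniq <- /(sorted_uniq ltn_trans ltnn) + _].
by rewrite cat_uniq => /and3P[].
Qed.

(** * Postponing the large elements *)

(** Moves that empty [HL] and [VL] into the output.  Only these two segments
    are mentioned, because the same moves are played with anything below them
    in the stacks and with any input ([drains_run]). *)
Inductive drains : seq nat -> seq nat -> seq nat -> seq nat -> Prop :=
| Drains_nil o : drains [::] [::] o o
| Drains_lam x HL VL o o' :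
    drains HL (x :: VL) o o' -> drains (x :: HL) VL o o'
| Drains_mu x HL VL o o' :
    drains HL VL (rcons o x) o' -> drains HL (x :: VL) o o'.

Lemma drains_run HL VL o o' I H V : drains HL VL o o' ->
  exists W d, run W (State I (HL ++ H) (VL ++ V) o) = Some (d, State I H V o').
Proof.
elim=> {HL VL o o'} [o | x HL VL o o' _ | x HL VL o o' _].
- by exists [::], [::].
- by case=> W [d /= run_W]; exists (Lam :: W), ((Lam, x) :: d); rewrite /= run_W.
- by case=> W [d /= run_W]; exists (Mu :: W), ((Mu, x) :: d); rewrite /= run_W.
Qed.

(** Induction on a completing word.  [HY] collects the newcomers, which sit
    above the small elements [HL] in [H].  Moving an element of [HY] or [HU]
    to [V] while [VL] is nonempty would cover a smaller element, and an element
    of [HU] is accessible only once [HL] is empty.  So a newcomer reaches [V]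
    when [VL] is empty and lands directly on [VR], exactly where it lands if
    the small elements have been drained beforehand. *)
Lemma drain_small q I HY HL HU VL VR o :
    sortable I (HY ++ HL ++ HU) (VL ++ VR) o ->
    all (gtn q) (HL ++ VL) -> all (leq q) (I ++ HY ++ HU ++ VR) ->
  exists2 o', drains HL VL o o' & sortable I (HY ++ HU) VR o'.
Proof.
move HE: (HY ++ HL ++ HU) => H; move VE: (VL ++ VR) => V sort_st.
elim: sort_st HY HL HU VL VR HE VE => {I H V o}
  [o o_sorted | x I H V o sort_st IH | x I H V o sort_st IH | x I H V o sort_st IH]
  HY HL HU VL VR HE VE.
- case: HY HL HU VL VR HE VE => [|//] [|//] [|//] [|//] [|//] _ _ _ _.
  by exists o; constructor.
- move=> small /= /andP[q_x large].
  have [||||o' drain sort_o'] := IH (x :: HY) HL HU VL VR => //=.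
  + by rewrite HE.
  + by move: large; rewrite !all_cat /= !all_cat q_x.
  + by exists o' => //; constructor.
- case: HY HE => [|y HY] /= HE.
    case: HL HE => [|z HL] /= HE.
      case: VL VE => [|v VL] VE small large.
        move: HE VE; rewrite /= => -> ->.
        by exists o; constructor.
      have /= := sortable_stackV sort_st; rewrite -VE /= => /andP[/andP[x_v _] _].
      move: small large; rewrite HE /= => /andP[v_q _].
      rewrite all_cat => /andP[_ /andP[q_x _]].
      by have := leq_ltn_trans q_x (ltn_trans x_v v_q); rewrite ltnn.
    case: HE => -> HE small large.
    have [||||o' drain sort_o'] := IH [::] HL HU (x :: VL) VR => //=.
    + by rewrite VE.
    + by move: small; rewrite /= !all_cat /= => /and3P[-> -> ->].
    + by exists o' => //; constructor.
  case: HE => yE HE; case: VL VE => [|v VL] VE small large.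
    have [||||o' drain sort_o'] := IH HY HL HU [::] (y :: VR) => //=.
    + by rewrite -VE yE.
    + by move: large; rewrite !all_cat /= !all_cat => /and5P[-> -> -> -> ->].
    + by exists o' => //; constructor.
  have /= := sortable_stackV sort_st; rewrite -VE /= => /andP[/andP[x_v _] _].
  move: small large; rewrite yE !all_cat /= => /and3P[_ v_q _] /and3P[_ q_x _].
  by have := leq_ltn_trans q_x (ltn_trans x_v v_q); rewrite ltnn.
- case: VL VE => [|v VL] /= VE small large.
    case: HL HE small => [|z HL] /= HE small.
      exists o; first by constructor.
      by rewrite HE VE; constructor.
    have x_z : x < z.
      apply: (sortable_output_lt sort_st); first by rewrite mem_rcons mem_head.
      by rewrite -HE !mem_cat mem_head !orbT.
    move: small large; rewrite VE !all_cat /= => /andP[z_q _] /and5P[_ _ _ q_x _].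
    by have := leq_ltn_trans q_x (ltn_trans x_z z_q); rewrite ltnn.
  case: VE small => -> VE small.
  have [||||o' drain sort_o'] := IH HY HL HU VL VR => //=.
  + by move: small; rewrite !all_cat /= => /and3P[-> _ ->].
  + by exists o' => //; constructor.
Qed.

(** Once the minimum [m] is in [V], no larger element can move to [V] before
    [m] is output; so only elements of [H] smaller than [m] are transferred
    meanwhile, and those form a prefix of [H] that is not interrupted by a
    larger element.  Leaving out the output of [m] gives a drain of the
    smaller elements. *)
Lemma drain_before_min_in_V m I HY H VL VR o :
    sortable I (HY ++ H) (VL ++ m :: VR) o ->
    all (gtn m) VL -> all (ltn m) (I ++ HY ++ VR) ->
  exists HL HU o', [/\ H = HL ++ HU, all (ltn m) HU, drains HL VL o o'
    & sortable I (HY ++ HU) VR (rcons o' m)].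
Proof.
move HE: (HY ++ H) => H'; move VE: (VL ++ m :: VR) => V sort_st.
elim: sort_st HY H VL HE VE => {I H' V o}
  [o o_sorted | x I H' V o sort_st IH | x I H' V o sort_st IH | x I H' V o sort_st IH]
  HY H VL HE VE.
- by case: VL VE.
- move=> small /= /andP[m_x large].
  have [||||HL [HU [o' [HE' HU_m drain sort_o']]]] := IH (x :: HY) H VL => //=.
  + by rewrite HE.
  + by move: large; rewrite !all_cat /= !all_cat m_x.
  + by exists HL, HU, o'; split=> //; constructor.
- have x_m : x < m.
    have := sortable_stackV sort_st; rewrite -VE pairwise_cons all_cat /=.
    by case/andP=> /and3P[].
  case: HY HE => [|y HY] /= HE small large; last first.
    case: HE large => -> _; rewrite all_cat /= => /and3P[_ m_x _].
    by have := ltn_trans m_x x_m; rewrite ltnn.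
  have [||||HL [HU [o' [HE' HU_m drain sort_o']]]] := IH [::] H' (x :: VL) => //=.
  + by rewrite VE.
  + by rewrite x_m.
  + by exists (x :: HL), HU, o'; split=> //; [rewrite HE HE' | constructor].
- case: VL VE => [|v VL] /= [xE VE] small large; subst x.
    exists [::], H, o; split=> //; [|by constructor | by rewrite HE VE].
    apply/allP=> y y_H; apply: (sortable_output_lt sort_st).
      by rewrite mem_rcons mem_head.
    by rewrite -HE !mem_cat y_H !orbT.
  have [||||HL [HU [o' [HE' HU_m drain sort_o']]]] := IH HY H VL => //=.
  + by case/andP: small.
  + by exists HL, HU, o'; split=> //; constructor.
Qed.

(** As long as [m] is in [H], the elements under it cannot move.  Only
    newcomers [HY] can go to [V], and, as [VL] must not be covered, this occurs
    after [VL] has been output; when [m] moves in turn,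
    [drain_before_min_in_V] takes over. *)
Lemma drain_before_min_in_H m I HY H VL VR o :
    sortable I (HY ++ m :: H) (VL ++ VR) o ->
    all (gtn m) VL -> all (ltn m) (I ++ HY ++ VR) ->
  exists HL HU o', [/\ H = HL ++ HU, all (ltn m) HU, drains HL VL o o'
    & sortable I (HY ++ HU) VR (rcons o' m)].
Proof.
move HE: (HY ++ m :: H) => H'; move VE: (VL ++ VR) => V sort_st.
elim: sort_st HY VL VR HE VE => {I H' V o}
  [o o_sorted | x I H' V o sort_st IH | x I H' V o sort_st IH | x I H' V o sort_st IH]
  HY VL VR HE VE.
- by case: HY HE.
- move=> small /= /andP[m_x large].
  have [||||HL [HU [o' [HE' HU_m drain sort_o']]]] := IH (x :: HY) VL VR => //=.
  + by rewrite HE.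
  + by move: large; rewrite !all_cat /= !all_cat m_x.
  + by exists HL, HU, o'; split=> //; constructor.
- case: VL VE => [|v VL] /= VE small large; last first.
    have m_x : m <= x.
      case: HY HE large => [|y HY] /= [<- _]; rewrite ?leqnn //.
      by rewrite all_cat /= => /and3P[_ /ltnW].
    have := sortable_stackV sort_st; rewrite -VE /= => /andP[/andP[x_v _] _].
    have v_m : v < m by case/andP: small.
    by have := leq_ltn_trans m_x (ltn_trans x_v v_m); rewrite ltnn.
  case: HY HE large => [|y HY] /= [xE HE] large; subst x.
    by subst V H'; apply: (@drain_before_min_in_V m I [::] H [::] VR).
  have [||||HL [HU [o' [HE' HU_m drain sort_o']]]] := IH HY [::] (y :: VR) => //=.
  + by rewrite VE.
  + by move: large; rewrite !all_cat /= !all_cat => /and4P[-> -> -> ->].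
  + by exists HL, HU, o'; split=> //; constructor.
- case: VL VE => [|v VL] /= VE small large.
    have x_m : x < m.
      apply: (sortable_output_lt sort_st); first by rewrite mem_rcons mem_head.
      by rewrite -HE !mem_cat mem_head !orbT.
    move: large; rewrite VE !all_cat /= => /and4P[_ _ m_x _].
    by have := ltn_trans m_x x_m; rewrite ltnn.
  case: VE small => -> VE small.
  have [||||HL [HU [o' [HE' HU_m drain sort_o']]]] := IH HY VL VR => //=.
  + by case/andP: small.
  + by exists HL, HU, o'; split=> //; constructor.
Qed.

(** * Decorated words and intermediate states *)

Lemma run_cat W1 W2 st : run (W1 ++ W2) st =
  if run W1 st is Some (d1, st1) then
    if run W2 st1 is Some (d2, st2) then Some (d1 ++ d2, st2) else None
  else None.
Proof.
elim: W1 st => [|a W1 IH] st /=; first by case: run => [[]|].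
case: step => [[x st1]|//]; rewrite IH.
by case: (run W1 st1) => [[d1 st2]|//]; case: run => [[]|].
Qed.

Definition trace (a : letter) (d : seq (letter * nat)) : seq nat :=
  [seq p.2 | p <- d & p.1 == a].

Lemma mem_trace a d x : (x \in trace a d) = ((a, x) \in d).
Proof.
apply/mapP/idP=> [[[b y]] | ax_d].
  by rewrite mem_filter /= => /andP[/eqP-> yd] ->.
by exists (a, x); rewrite // mem_filter /= eqxx.
Qed.

(** The last component records the stack discipline of [H]: read from bottom
    to top and followed by the input, [H] is always a subword of the initial
    word. *)
Lemma run_invariants W I H V o d I' H' V' o' :
    run W (State I H V o) = Some (d, State I' H' V' o') ->
  [/\ size d = size W, I = trace Rho d ++ I', o' = o ++ trace Mu d,
      perm_eq (I ++ H ++ V ++ o) (I' ++ H' ++ V' ++ o')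
    & subseq (rev H' ++ I') (rev H ++ I)].
Proof.
elim: W I H V o d => [|a W IH] I H V o d /=.
  by case=> <- <- <- <- <-; rewrite /trace /= cats0 perm_refl subseq_refl.
case: a; [case: I => // x I | case: H => // x H | case: V => // x V];
  rewrite /=; case run_W: run => [[d' st]|//] [<- st_eq];
  rewrite st_eq in run_W; case/IH: run_W => {IH st st_eq d} size_d I_eq o_eq perm_st sub_st.
- rewrite /= size_d; split=> //.
  + by rewrite /trace /= -/(trace _ _) -I_eq.
  + apply: perm_trans perm_st.
    by apply/permP=> P; rewrite /= !count_cat /= ?count_cat addnCA.
  + by rewrite rev_cons cat_rcons in sub_st.
- rewrite /= size_d; split=> //.
  + apply: perm_trans perm_st; rewrite perm_cat2l.
    by apply/permP=> P; rewrite /= !count_cat /= ?count_cat addnCA.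
  + apply: subseq_trans sub_st _; rewrite rev_cons cat_rcons.
    by rewrite subseq_cat2l subseq_cons.
- rewrite /= size_d; split=> //.
  + by rewrite o_eq cat_rcons.
  + apply: perm_trans perm_st; rewrite !perm_cat2l.
    by rewrite -cats1 catA perm_sym perm_catC perm_refl.
Qed.

(** Property (P) speaks of positions in the decorated word; this reduces its
    order conditions to the content of a single intermediate state. *)
Lemma mu_before_rho s W1 W2 d1 d st st1 x y :
    run W1 (init s) = Some (d1, st1) -> run (W1 ++ W2) (init s) = Some (d, st) ->
    uniq s -> input st = [::] -> x \in output st1 -> y \in input st1 ->
  before d (Mu, x) (Rho, y).
Proof.
move=> run1; rewrite run_cat run1; case run2: run => [[d2 st2]|//] [<- <-].
case: st1 st2 run1 run2 => I1 H1 V1 o1 [I2 H2 V2 o2].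
case/run_invariants=> _ s_eq o1_eq _ _; case/run_invariants=> _ I1_eq _ _ _.
move=> uniq_s /= I2_nil x_o1 y_I1; subst I2.
have Mu_d1 : (Mu, x) \in d1 by rewrite -mem_trace; move: x_o1; rewrite o1_eq.
have Rho_d2 : (Rho, y) \in d2 by rewrite -mem_trace; move: y_I1; rewrite I1_eq cats0.
have Rho_d1 : (Rho, y) \notin d1.
  rewrite -mem_trace; apply/negP=> y_d1; move: uniq_s; rewrite s_eq cat_uniq.
  by case/and3P=> _ /hasPn/(_ y y_I1); rewrite y_d1.
rewrite /before mem_cat Rho_d2 orbT !index_cat Mu_d1 (negPf Rho_d1).
by rewrite (leq_trans _ (leq_addr _ _)) // index_mem.
Qed.

(** * Normalizing at a right-to-left minimum *)

Lemma pairwise_split (P : pred nat) t :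
  pairwise (fun a b => P a ==> P b) t ->
  t = [seq x <- t | ~~ P x] ++ [seq x <- t | P x].
Proof.
elim: t => //= x t IH /andP[Px_t t_pw]; case Px: (P x) => /=; last by rewrite -IH.
have all_P : all P t by apply: sub_all Px_t => y; rewrite Px.
rewrite (all_filterP all_P); suff -> : [seq y <- t | ~~ P y] = [::] by [].
by apply/eqP; rewrite -(negbK (_ == _)) -has_filter -all_predC;
   apply: sub_all all_P => y /=; rewrite negbK.
Qed.

Lemma increasing_split (P : pred nat) t : {homo P : a b / a < b >-> a ==> b} ->
  pairwise ltn t -> t = [seq x <- t | ~~ P x] ++ [seq x <- t | P x].
Proof. by move=> P_homo t_pw; apply: pairwise_split; apply: sub_pairwise t_pw. Qed.

(** Here [y] is a right-to-left minimum, [past] and [suf] are the elements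
    before and after it.  The pairwise condition says that the larger elements
    of [past] form a word with entries at least [q] followed by a word with
    entries below [q]. *)
Definition flushable (past : seq nat) y (suf : seq nat) q : bool :=
  pairwise (fun a b => (a < q) ==> (b < q)) [seq x <- past | y < x]
  && all (leq q) suf.

(** The stack [H] reversed is a subword of the larger part of [past], so its
    elements below [q] are its topmost ones, as [drain_small] requires. *)
Lemma flush past y suf H V o q W0 d0 :
    uniq (past ++ y :: suf) ->
    run W0 (init (past ++ y :: suf)) = Some (d0, State suf H V o) ->
    sortable suf H V o -> all (ltn y) (H ++ V) -> flushable past y suf q ->
  exists b db H' V' o', [/\ run b (State suf H V o) = Some (db, State suf H' V' o'),
    sortable suf H' V' o' & {in past, forall x, x < q -> x \in o'}].
Proof.
move=> uniq_s run0 sort_st y_HV /andP[u_pw suf_q].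
have [_ _ _ perm0 sub0] := run_invariants run0.
have H_sub : subseq (rev H) [seq x <- past | y < x].
  rewrite subseq_filter; move: y_HV; rewrite all_cat all_rev => /andP[y_H _].
  rewrite y_H /=; move: sub0; rewrite /= -cat_rcons subseq_cat2r => rH_sub.
  have : subseq (rev H) [seq x <- rcons past y | y < x].
    by rewrite subseq_filter all_rev y_H.
  by rewrite filter_rcons ltnn subseq_filter => /andP[].
have rH_split := pairwise_split (subseq_pairwise H_sub u_pw).
have V_split : V = [seq x <- V | ~~ (q <= x)] ++ [seq x <- V | q <= x].
  apply: increasing_split (sortable_stackV sort_st) => a b a_b.
  by apply/implyP=> /leq_trans-> //; apply: ltnW.
set HL := rev [seq x <- rev H | x < q]; set HU := rev [seq x <- rev H | ~~ (x < q)].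
have H_split : H = HL ++ HU by rewrite /HL /HU -rev_cat -rH_split revK.
move: V_split; set VL := filter _ _; set VR := filter _ _ => V_split.
have [] := @drain_small q suf [::] HL HU VL VR o.
- by rewrite /= -H_split -V_split.
- by rewrite all_cat all_rev filter_all /=; apply/allP=> x; rewrite mem_filter -ltnNge => /andP[].
- rewrite !all_cat suf_q all_rev filter_all /= andbT.
  by apply/allP=> x; rewrite mem_filter -leqNgt => /andP[].
move=> o' drain sort_o'.
have [b [db run_b]] := drains_run suf HU VR drain.
rewrite -H_split -V_split in run_b.
exists b, db, HU, VR, o'; split=> // x x_past x_q.
have : x \in (past ++ y :: suf) ++ [::] ++ [::] ++ [::].
  by rewrite !mem_cat x_past.
rewrite (perm_mem perm0); have [_ _ _ /perm_mem-> _] := run_invariants run_b.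
rewrite !mem_cat; case/or4P=> //.
- by move/(allP suf_q); rewrite leqNgt x_q.
- by rewrite mem_rev mem_filter x_q.
- by rewrite mem_filter leqNgt x_q.
Qed.

(** Flushing for the largest admissible threshold up to [N] settles all the
    smaller ones.  The bound [N] only serves to make a largest one exist. *)
Lemma flush_all N past y suf H V o W0 d0 :
    uniq (past ++ y :: suf) ->
    run W0 (init (past ++ y :: suf)) = Some (d0, State suf H V o) ->
    sortable suf H V o -> all (ltn y) (H ++ V) ->
  exists b db H' V' o', [/\ run b (State suf H V o) = Some (db, State suf H' V' o'),
    sortable suf H' V' o'
    & forall q, q <= N -> flushable past y suf q ->
        {in past, forall x, x < q -> x \in o'}].
Proof.
move=> uniq_s run0 sort_st y_HV; elim: N => [|N IH].
  exists [::], [::], H, V, o; split=> // q; rewrite leqn0 => /eqP-> _ x _.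
  by rewrite ltn0.
have [flush_N | not_flush_N] := boolP (flushable past y suf N.+1).
  have [b [db [H' [V' [o' [run_b sort_o' out_o']]]]]] := flush uniq_s run0 sort_st y_HV flush_N.
  exists b, db, H', V', o'; split=> // q q_N _ x x_past x_q.
  by apply: out_o' => //; apply: leq_trans q_N.
have [b [db [H' [V' [o' [run_b sort_o' out_o']]]]]] := IH.
exists b, db, H', V', o'; split=> // q; rewrite leq_eqVlt => /predU1P[-> | /out_o' //].
by rewrite (negPf not_flush_N).
Qed.

Lemma run_to_rho y I H V o : sortable (y :: I) H V o ->
  exists a da H' V' o',
    run a (State (y :: I) H V o) = Some (da, State (y :: I) H' V' o')
    /\ sortable I (y :: H') V' o'.
Proof.
move yI: (y :: I) => J sort_st.
elim: sort_st yI => {J H V o}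
  [//|x J H V o sort_st _ [-> ->]|x J H V o _ IH yI|x J H V o _ IH yI].
- by exists [::], [::], H, V, o.
- have [a [da [H' [V' [o' [run_a ?]]]]]] := IH yI.
  by exists (Lam :: a), ((Lam, x) :: da), H', V', o'; rewrite /= run_a.
- have [a [da [H' [V' [o' [run_a ?]]]]]] := IH yI.
  by exists (Mu :: a), ((Mu, x) :: da), H', V', o'; rewrite /= run_a.
Qed.

(** The completing word is followed up to the push of [y], since reaching the
    small elements may require moving larger ones that cover them; then the
    small elements are drained and the push is postponed after them. *)
Lemma run_to_min y I H V o : sortable (y :: I) H V o -> all (ltn y) I ->
  exists a da H' V' o',
    [/\ run a (State (y :: I) H V o) = Some (da, State (y :: I) H' V' o'),
        all (ltn y) (H' ++ V') & sortable I H' V' (rcons o' y)].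
Proof.
move=> /run_to_rho[a [da [H1 [V1 [o1 [run_a sort_st]]]]]] y_I.
have V_split : V1 = [seq x <- V1 | ~~ (y < x)] ++ [seq x <- V1 | y < x].
  apply: increasing_split (sortable_stackV sort_st) => b c b_c.
  by apply/implyP=> /ltn_trans->.
have y_V1 : y \notin V1.
  have := sortable_uniq sort_st.
  by rewrite cat_uniq => /and3P[_ _ /=]; rewrite mem_cat negb_or -andbA => /and3P[].
move: V_split; set VL := filter _ _; set VR := filter _ _ => V_split.
have y_VR : all (ltn y) VR by apply: filter_all.
have [] := @drain_before_min_in_H y I [::] H1 VL VR o1.
- by rewrite /= -V_split.
- apply/allP=> x; rewrite mem_filter -leqNgt => /andP[x_y x_V1].
  by rewrite /= ltn_neqAle x_y andbT; apply: contraNneq y_V1 => <-.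
- by rewrite !all_cat y_I.
move=> HL [HU [o' [H1_split y_HU drain sort_o']]].
have [b [db run_b]] := drains_run (y :: I) HU VR drain.
rewrite -H1_split -V_split in run_b.
exists (a ++ b), (da ++ db), HU, VR, o'; split=> //.
- by rewrite run_cat run_a run_b.
- by rewrite all_cat y_HU.
Qed.

(** What Property (P) asks at one minimum [y], in terms of states: [a] leads to
    the time just before [y] is pushed, and [b] is the flush that follows its
    output and precedes the next push. *)
Inductive checkpoint N s (past : seq nat) y (suf : seq nat) W : Prop :=
  Checkpoint a b c da db H1 V1 o1 H2 V2 o2 of
      W = a ++ [:: Rho; Lam; Mu] ++ b ++ c
    & run a (init s) = Some (da, State (y :: suf) H1 V1 o1)
    & all (ltn y) (H1 ++ V1)
    & run b (State suf H1 V1 (rcons o1 y)) = Some (db, State suf H2 V2 o2)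
    & forall q, q <= N -> flushable past y suf q ->
        {in past, forall x, x < q -> x \in o2}.

Lemma checkpoint_cat N s past y suf W W' :
  checkpoint N s past y suf W -> checkpoint N s past y suf (W ++ W').
Proof.
case=> a b c da db H1 V1 o1 H2 V2 o2 -> run_a y_HV run_b out_o2.
by apply: Checkpoint run_a y_HV run_b out_o2; rewrite -!catA.
Qed.

(** Induction on the part of the input already read.  The invariant that the
    state reached is [sortable] allows the next element to be treated, and
    earlier checkpoints are not affected by prolonging the word. *)
Lemma checkpointed_prefix N s (past inp : seq nat) :
    uniq s -> sortable s [::] [::] [::] -> s = past ++ inp ->
  exists W d H V o, [/\ run W (init s) = Some (d, State inp H V o),
    sortable inp H V o
    & forall pre y mid, past = pre ++ y :: mid -> all (ltn y) (mid ++ inp) ->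
        checkpoint N s pre y (mid ++ inp) W].
Proof.
move=> uniq_s sort_s; elim/last_ind: past inp => [|past x IH] inp s_eq.
  exists [::], [::], [::], [::], [::]; split=> //; first by rewrite s_eq.
    by rewrite -[inp]s_eq.
  by case.
rewrite cat_rcons in s_eq.
have [W [d [H [V [o [run_W sort_st cps]]]]]] := IH _ s_eq.
have split_past pre y mid : rcons past x = pre ++ y :: mid ->
    [/\ pre = past, y = x & mid = [::]]
    \/ exists2 mid', past = pre ++ y :: mid' & mid = rcons mid' x.
  case/lastP: mid => [|mid z]; first by rewrite cats1 => /rcons_inj[-> ->]; left.
  by rewrite -rcons_cons -rcons_cat => /rcons_inj[-> ->]; right; exists mid.
have old_cps W' pre y mid : past = pre ++ y :: mid ->
    all (ltn y) (rcons mid x ++ inp) ->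
    checkpoint N s pre y (rcons mid x ++ inp) (W ++ W').
  by rewrite cat_rcons => past_eq y_lt; apply/checkpoint_cat/cps.
have [x_inp | not_x_inp] := boolP (all (ltn x) inp); last first.
  have [a [da [H1 [V1 [o1 [run_a sort_o1]]]]]] := run_to_rho sort_st.
  exists (W ++ a ++ [:: Rho]), (d ++ da ++ [:: (Rho, x)]), (x :: H1), V1, o1.
  split=> //; first by rewrite run_cat run_W run_cat run_a.
  move=> pre y mid /split_past[[-> -> ->]|[mid' past_eq ->]] y_lt; last exact: old_cps.
  by rewrite /= y_lt in not_x_inp.
have [a [da [H1 [V1 [o1 [run_a y_HV sort_o1]]]]]] := run_to_min sort_st x_inp.
have run_Wa : run (W ++ a) (init s) = Some (d ++ da, State (x :: inp) H1 V1 o1).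
  by rewrite run_cat run_W run_a.
have run_x : run (W ++ a ++ [:: Rho; Lam; Mu]) (init s) =
    Some ((d ++ da) ++ [:: (Rho, x); (Lam, x); (Mu, x)], State inp H1 V1 (rcons o1 x)).
  by rewrite catA run_cat run_Wa.
have run_x' := run_x; rewrite s_eq in run_x' uniq_s.
have [b [db [H2 [V2 [o2 [run_b sort_o2 out_o2]]]]]] :=
  flush_all N uniq_s run_x' sort_o1 y_HV.
exists (W ++ a ++ [:: Rho; Lam; Mu] ++ b).
exists (((d ++ da) ++ [:: (Rho, x); (Lam, x); (Mu, x)]) ++ db), H2, V2, o2.
split=> //.
  by rewrite (catA a) (catA W) run_cat run_x run_b.
move=> pre y mid /split_past[[-> -> ->]|[mid' past_eq ->]] y_lt; last exact: old_cps.
have W_eq : W ++ a ++ [:: Rho; Lam; Mu] ++ b =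
    (W ++ a) ++ [:: Rho; Lam; Mu] ++ b ++ [::] by rewrite cats0 -!catA.
exact: Checkpoint W_eq run_Wa y_HV run_b out_o2.
Qed.

(** * Skew decompositions *)

Lemma size_nonempty_blocks (Bs : seq (seq nat)) :
  [::] \notin Bs -> size Bs <= size (flatten Bs).
Proof.
elim: Bs => //= B Bs IH; rewrite inE negb_or => /andP[B_n0 /IH Bs_le].
by rewrite size_cat -add1n leq_add // lt0n size_eq0 eq_sym.
Qed.

(** A factorization of [u] into nonempty blocks is determined by the lengths
    of its blocks, so there are finitely many of each size and a maximal size
    is attained.  Encoding the lengths as bounded tuples makes the existence of
    a factorization with [k] blocks decidable. *)
Lemma skew_decomposition_exists u : exists Bs, skew_decomposition u Bs.
Proof.
pose factb (Bs : seq (seq nat)) := [&& flatten Bs == u, [::] \notin Bs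
  & pairwise (fun B C => allrel (fun b c => c < b) B C) Bs].
have factP Bs : reflect (skew_factorization u Bs) (factb Bs).
  by apply: (iffP and3P) => -[/eqP].
pose P k := [exists sh : k.-tuple 'I_(size u).+1, factb (reshape (map val sh) u)].
have P_size Cs : skew_factorization u Cs -> P (size Cs).
  case=> u_eq Cs_n0 Cs_pw.
  have sh_size : size [seq inord (size C) : 'I_(size u).+1 | C <- Cs] == size Cs.
    by rewrite size_map.
  apply/existsP; exists (Tuple sh_size); rewrite /= -map_comp.
  have -> : map (val \o (fun C => inord (size C) : 'I_(size u).+1)) Cs = shape Cs.
    apply/eq_in_map=> C C_Cs /=; rewrite inordK // ltnS -u_eq.
    rewrite size_flatten sumnE big_map.
    by rewrite (big_rem C) //= leq_addr.
  by apply/factP; rewrite -{2}u_eq flattenK; split.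
have size_P k : P k -> exists2 Bs, skew_factorization u Bs & size Bs = k.
  case/existsP=> sh /factP fact_sh; exists (reshape (map val sh) u) => //.
  by rewrite size_reshape size_map size_tuple.
have P_bounded k : P k -> k <= size u.
  by case/size_P=> Bs [<- Bs_n0 _] <-; apply: size_nonempty_blocks.
have P_inhabited : exists k, P k.
  case: (altP (u =P [::])) => [u_nil | u_n0].
    by exists 0; apply: (P_size [::]); split; rewrite ?u_nil.
  exists 1; apply: (P_size [:: u]); split=> //=; first by rewrite cats0.
  by rewrite inE eq_sym.
case: (ex_maxnP P_inhabited P_bounded) => k /size_P[Bs fact_Bs <-] k_max.
by exists Bs; split=> // Cs /P_size/k_max.
Qed.

(** The least threshold above the trailing blocks works: the leading blocks are
    larger than the trailing ones and come before them, and [suf] is also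
    larger than the trailing ones. *)
Lemma skew_tail_flushable (past : seq nat) y suf Bs p :
    skew_factorization [seq x <- past | y < x] Bs ->
    (forall b x, b \in flatten (drop p Bs) -> x \in suf -> b < x) ->
  flushable past y suf (\max_(b <- flatten (drop p Bs)) b.+1).
Proof.
case=> u_eq _ Bs_pw tail_suf; set L := flatten (drop p Bs); set q := \max_(b <- L) _.
have L_q b : b \in L -> b < q by move=> b_L; apply: (leq_bigmax_seq (F := S)).
have q_le x : {in L, forall b, b < x} -> q <= x.
  by move=> L_x; apply/bigmax_leqP_seq => b b_L _; apply: L_x.
apply/andP; split; last by apply/allP=> x x_suf; apply: q_le => b b_L; apply: tail_suf.
move: Bs_pw; rewrite -u_eq -(cat_take_drop p Bs) flatten_cat pairwise_cat.
rewrite -/L => /and3P[/allrelP U_L _ _].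
have {U_L} q_U a : a \in flatten (take p Bs) -> q <= a.
  case/flattenP=> B B_U a_B; apply: q_le => b /flattenP[C C_L b_C].
  by have /allrelP := U_L _ _ B_U C_L; apply.
rewrite pairwise_cat; apply/and3P; split.
- by apply/allrelP=> a b _ /L_q->; rewrite implybT.
- apply/(pairwiseP 0) => k l; rewrite !inE => k_lt _ _.
  by apply/implyP; rewrite ltnNge q_U // mem_nth.
- apply/(pairwiseP 0) => k l; rewrite !inE => _ l_lt _.
  by apply/implyP=> _; rewrite L_q // mem_nth.
Qed.

(** The minimum of [A] lies in block number [p_index A Bs], and the blocks
    after that one contain only smaller elements. *)
Lemma tail_below_A (A u : seq nat) Bs x :
    skew_factorization u Bs -> {subset A <= u} ->
    x \in flatten (drop (p_index A Bs) Bs) -> x \notin A.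
Proof.
case=> u_eq _ Bs_pw; case: A => [//|a A] A_u; set p := p_index _ _ => x_L.
pose m := foldr minn a A.
have m_le y : y \in a :: A -> m <= y.
  rewrite /m inE; elim: A {A_u p x_L m} => [|b A IH] /=; first by rewrite orbF => /eqP->.
  rewrite inE geq_min orbCA; case/orP=> [/eqP->|/IH->]; rewrite ?leqnn ?orbT //.
have m_A : m \in a :: A.
  rewrite /m; elim: A {A_u p x_L m m_le} => [|b A IH] /=; first exact: mem_head.
  case: (leqP b (foldr minn a A)) => _; first by rewrite !inE eqxx orbT.
  by move: IH; rewrite !inE => /orP[->|->]; rewrite ?orbT.
apply/negP=> /m_le m_x.
have m_has : has (fun B : seq nat => m \in B) Bs.
  by have := A_u _ m_A; rewrite -u_eq => /flattenP[B B_Bs m_B]; apply/hasP; exists B.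
move: Bs_pw; rewrite -(cat_take_drop p Bs) pairwise_cat => /and3P[/allrelP U_L _ _].
have m_U : nth [::] Bs p.-1 \in take p Bs.
  rewrite -(nth_take [::] (ltnSn p.-1)) mem_nth // size_take_min.
  by rewrite leq_min leqnn -has_find.
case/flattenP: x_L => C C_L x_C.
have /allrelP/(_ m x (nth_find [::] m_has) x_C) := U_L _ _ m_U C_L.
by rewrite ltnNge m_x.
Qed.

(** * Right-to-left minima *)

(** Take [k] to be [j] if it is a right-to-left minimum; otherwise some later
    entry is smaller, and the search goes on from there. *)
Lemma exists_rl_minimum s j : j < size s ->
  exists k, [/\ k \in rl_minima s, j <= k & nth 0 s k <= nth 0 s j].
Proof.
have [n] := ubnP (size s - j); elim: n j => // n IH j size_j j_lt.
have [j_min | ] := boolP (all (fun x => nth 0 s j <= x) (drop j.+1 s)).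
  by exists j; rewrite mem_filter j_min mem_iota.
case/allPn=> x /(nthP 0)[l]; rewrite size_drop ltn_subRL => l_lt.
rewrite nth_drop -ltnNge => <- lt_j.
have [||k [k_min k_ge k_le]] := IH (j.+1 + l) => //.
  by rewrite -ltnS (leq_trans _ size_j) // ltnS ltn_sub2l // addSn ltnS leq_addr.
exists k; split=> //; first by rewrite (leq_trans _ k_ge) // addSn -addnS leq_addr.
by rewrite (leq_trans k_le) // ltnW.
Qed.

Lemma rl_minimaP s k : reflect (k < size s /\ all (leq (nth 0 s k)) (drop k.+1 s))
  (k \in rl_minima s).
Proof.
by rewrite mem_filter mem_iota /= add0n andbC; apply: andP.
Qed.

Lemma pos_min_lt s i j : i < j -> j < size (rl_minima s) -> pos_min s i < pos_min s j.
Proof.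
move=> i_j j_r; apply: (sorted_ltn_nth ltn_trans) => //; last first.
  by rewrite inE (ltn_trans i_j).
by apply: sorted_filter; [exact: ltn_trans | exact: iota_ltn_sorted].
Qed.

(** Every entry after a right-to-left minimum dominates a later right-to-left
    minimum, and the next one is the smallest of those. *)
Lemma val_min_next_le s i x : i.+1 < size (rl_minima s) ->
  x \in drop (pos_min s i).+1 s -> val_min s i.+1 <= x.
Proof.
move=> i_r /(nthP 0)[l]; rewrite size_drop ltn_subRL nth_drop => l_lt <-.
have [k [k_min k_ge k_le]] := exists_rl_minimum l_lt.
have k_i : pos_min s i < k by apply: leq_trans k_ge; rewrite addSn ltnS leq_addr.
apply: leq_trans k_le; move: k_i; rewrite -(nth_index 0 k_min).
set j := index k _ => k_i.
have j_r : j < size (rl_minima s) by rewrite index_mem.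
have i_j : i < j.
  rewrite ltnNge; apply: contraL k_i; rewrite -leqNgt leq_eqVlt.
  by case/predU1P=> [-> | j_i]; rewrite ?leqnn // ltnW // pos_min_lt // ltnW.
move: i_j; rewrite leq_eqVlt => /predU1P[<- // | /pos_min_lt/(_ j_r) k_lt].
have /rl_minimaP[_ /allP] : pos_min s i.+1 \in rl_minima s by apply: mem_nth.
have k_size : pos_min s j < size s.
  by rewrite /pos_min nth_index //; case/rl_minimaP: k_min.
apply; rewrite -/(pos_min s j) -(subnKC k_lt) -nth_drop mem_nth //.
by rewrite size_drop ltn_sub2r // (leq_ltn_trans k_lt).
Qed.

(** * Property (P) from the checkpoints *)

Lemma final_stateE s W d st : run W (init s) = Some (d, st) ->
  final_state s W = Some st /\ decorated s W = d.
Proof. by rewrite /final_state /decorated => ->. Qed.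

Lemma split_at_min s i (k := pos_min s i) : uniq s -> i < size (rl_minima s) ->
  [/\ k < size s, s = take k s ++ val_min s i :: drop k.+1 s
    & all (ltn (val_min s i)) (drop k.+1 s)].
Proof.
move=> uniq_s i_r; have /rl_minimaP[k_s m_min] : k \in rl_minima s by apply: mem_nth.
have s_eq : s = take k s ++ val_min s i :: drop k.+1 s.
  by rewrite -drop_nth // cat_take_drop.
split=> //; apply/allP=> x x_suf; rewrite /= ltn_neqAle (allP m_min) // andbT.
have := uniq_s; rewrite {1}s_eq cat_uniq /= => /and4P[_ _ m_suf _].
by apply: contraNneq m_suf => ->.
Qed.

(** At the push of the minimum [m], the elements read so far are in the stacks
    if they are larger than [m] and in the output if they are smaller; this
    gives the content of the stacks and condition (ii).  For condition (iii),
    the threshold of [skew_tail_flushable] is one of those treated by the flush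
    of the checkpoint. *)
Lemma checkpoint_at_min N s W d o i (k := pos_min s i) :
    uniq s -> all (gtn N) s -> i < size (rl_minima s) ->
    run W (init s) = Some (d, State [::] [::] [::] o) -> sorted ltn o ->
    checkpoint N s (take k s) (val_min s i) (drop k.+1 s) W ->
  property_P_at s W i /\
  exists2 st, state_at_min s W i = Some st & stackH st ++ stackV st =i sigma_sub s i.
Proof.
move=> uniq_s s_N i_r run_W o_sorted.
have [k_s s_eq m_suf] := split_at_min uniq_s i_r; rewrite -/k in k_s s_eq m_suf.
move: m_suf s_eq; set m := val_min s i; set suf := drop _ s; set past := take _ s.
move=> m_suf s_eq [a b c da db H1 V1 o1 H2 V2 o2 W_eq run_a m_HV run_b out_o2].
have [_ d_eq] := final_stateE run_W.
have run_ax : run (a ++ [:: Rho; Lam; Mu]) (init s) =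
    Some (da ++ [:: (Rho, m); (Lam, m); (Mu, m)], State suf H1 V1 (rcons o1 m)).
  by rewrite run_cat run_a.
have run_axb : run ((a ++ [:: Rho; Lam; Mu]) ++ b) (init s) =
    Some ((da ++ [:: (Rho, m); (Lam, m); (Mu, m)]) ++ db, State suf H2 V2 o2).
  by rewrite run_cat run_ax run_b.
have [dc d_split] : exists dc, d = ((da ++ [:: (Rho, m); (Lam, m); (Mu, m)]) ++ db) ++ dc.
  move: run_W; rewrite W_eq (catA a) (catA _ b) run_cat run_axb.
  by case: run => [[dc st]|//] [<- _]; exists dc.
have [size_da s_da _ perm_a _] := run_invariants run_a.
(* The tail of the word completes the state after the output of [m]; undoing
   the last two moves shows that everything output earlier is below [m]. *)
have sort_x : sortable suf H1 V1 (rcons o1 m).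
  move: run_W; rewrite W_eq catA run_cat run_ax.
  case run_bc: run => [[d' st]|//] [_ st_eq]; rewrite st_eq in run_bc.
  exact: run_sortable run_bc o_sorted.
have out_lt x : x \in o1 -> x < m.
  move=> x_o1; apply: (sortable_output_lt (Sortable_lam (Sortable_mu sort_x)) x_o1).
  by rewrite !mem_cat mem_head !orbT.
have past_perm : perm_eq past (H1 ++ V1 ++ o1).
  by rewrite -(perm_cat2r (m :: suf)) -s_eq perm_sym perm_catC perm_sym -[s]cats0.
split; last first.
  exists (State (m :: suf) H1 V1 o1).
    rewrite /state_at_min d_eq d_split -!catA index_pivot; last first.
      rewrite -mem_trace; apply/negP=> m_da; have := uniq_s; rewrite s_da cat_uniq.
      by case/and3P=> _ /hasPn/(_ m (mem_head _ _)); rewrite m_da.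
    by rewrite W_eq size_da take_size_cat // (proj1 (final_stateE run_a)).
  move=> x /=; rewrite /sigma_sub mem_filter -/k -/past -/m (perm_mem past_perm).
  rewrite catA [in RHS]mem_cat.
  apply/idP/andP=> [x_HV | [m_x]].
    by split; [exact: (allP m_HV) | rewrite x_HV].
  by case/orP=> // /out_lt; rewrite ltnNge ltnW.
rewrite /property_P_at d_eq; split.
- by rewrite d_split -!catA; apply: infix_infix.
- move=> x x_s x_m; rewrite -d_eq.
  have run_W' := run_W; rewrite W_eq in run_W'.
  rewrite /decorated W_eq run_W'.
  apply: (mu_before_rho run_a run_W') => //=; last exact: mem_head.
  move: x_s; rewrite -[s]cats0 (perm_mem perm_a) !mem_cat inE -!orbA.
  case/predU1P=> [x_eq | /or4P[x_suf | x_H | x_V | //]].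
  + by rewrite x_eq ltnn in x_m.
  + by have := allP m_suf _ x_suf; rewrite /= ltnNge ltnW.
  + by have := allP m_HV x; rewrite mem_cat x_H /= ltnNge ltnW // => /(_ isT).
  + by have := allP m_HV x; rewrite mem_cat x_V orbT /= ltnNge ltnW // => /(_ isT).
- move=> i_r1; have [Bs Bs_dec] := skew_decomposition_exists (sigma_sub s i).
  exists Bs => // j x /andP[p_j j_Bs] x_j; set p := p_index _ _ in p_j.
  have [u_eq Bs_n0 Bs_pw] := Bs_dec.1.
  have x_L : x \in flatten (drop p Bs).
    apply/flattenP; exists (nth [::] Bs j.-1) => //.
    rewrite -(subnKC p_j) addSn /= -nth_drop mem_nth // size_drop.
    by rewrite ltn_subRL -addSn subnKC.
  have mem_u y : y \in flatten (drop p Bs) -> (m < y) && (y \in past).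
    rewrite -mem_filter -/(sigma_sub s i) -u_eq -{2}(cat_take_drop p Bs).
    by rewrite flatten_cat mem_cat => ->; rewrite orbT.
  have pos_i1 := pos_min_lt (ltnSn i) i_r1.
  have [k1_s _ _] := split_at_min uniq_s i_r1.
  have m1_suf : val_min s i.+1 \in suf.
    rewrite /val_min -(subnKC pos_i1) -nth_drop mem_nth // size_drop ltn_sub2r //.
    exact: leq_ltn_trans k1_s.
  (* A trailing element at least as large as the next minimum would belong to
     [A_sub s i], whose elements all lie in the leading blocks. *)
  have tail_suf z y : z \in flatten (drop p Bs) -> y \in suf -> z < y.
    move=> z_L /(val_min_next_le i_r1); apply: leq_trans.
    have /andP[m_z z_past] := mem_u z z_L.
    rewrite ltnNge; apply: contraL z_L; rewrite leq_eqVlt => /predU1P[z_eq | z_A].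
      have := uniq_s; rewrite {1}s_eq cat_uniq => /and3P[_ /hasPn/(_ z)].
      by rewrite -z_eq inE m1_suf orbT z_eq z_past => /(_ isT).
    have A_u : {subset A_sub s i <= sigma_sub s i}.
      move=> y'; rewrite !mem_filter => /andP[z_m1 ->]; rewrite andbT.
      exact: ltn_trans (allP m_suf _ m1_suf) z_m1.
    apply/negP=> /(tail_below_A Bs_dec.1 A_u).
    by rewrite mem_filter z_A z_past.
  have flush_L := skew_tail_flushable Bs_dec.1 tail_suf.
  have x_o2 : x \in o2.
    have /andP[m_x x_past] := mem_u x x_L.
    apply: out_o2 flush_L _ x_past _; last exact: (leq_bigmax_seq (F := S)).
    apply/bigmax_leqP_seq => z /mem_u/andP[_ z_past] _.
    by apply: (allP s_N); rewrite s_eq mem_cat z_past.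
  have run_W' := run_W; rewrite W_eq (catA a) (catA _ b) in run_W'.
  rewrite -d_eq /decorated W_eq (catA a) (catA _ b) run_W'.
  apply: (mu_before_rho run_axb run_W') => //=.
  rewrite -[k.+1]addn0 -nth_drop mem_nth // size_drop subn_gt0.
  exact: leq_ltn_trans k1_s.
Qed.

Theorem theorem19 (n : nat) (s : seq nat) (perm_s : perm_eq s (iota 1 n))
    (sortable_s : two_stack_sortable s) :
  exists w : seq letter,
    [/\ sorting_word s w,
        property_P s w
      & forall i : nat, i < size (rl_minima s) ->
        exists2 st : state, state_at_min s w i = Some st &
          stackH st ++ stackV st =i sigma_sub s i].
Proof.
have uniq_s : uniq s by rewrite (perm_uniq perm_s) iota_uniq.
have s_n : size s = n by rewrite (perm_size perm_s) size_iota.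
have sort_s : sortable s [::] [::] [::].
  case: sortable_s => W; rewrite /sorting_word /final_state.
  case run_W: run => [[d st]|//] [st_eq]; rewrite st_eq in run_W.
  exact: run_sortable run_W (iota_ltn_sorted _ _).
have [|W [d [H [V [o [run_W sort_st cps]]]]]] :=
  @checkpointed_prefix n.+1 s s [::] uniq_s sort_s; first by rewrite cats0.
have [c [dc [o' [run_c o'_sorted]]]] := sortable_run sort_st.
have run_Wc : run (W ++ c) (init s) = Some (d ++ dc, State [::] [::] [::] o').
  by rewrite run_cat run_W run_c.
have at_min i : i < size (rl_minima s) ->
    property_P_at s (W ++ c) i /\
    exists2 st, state_at_min s (W ++ c) i = Some st
      & stackH st ++ stackV st =i sigma_sub s i.
  move=> i_r; have [_ s_eq m_suf] := split_at_min uniq_s i_r.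
  apply: (checkpoint_at_min (N := n.+1) uniq_s _ i_r run_Wc o'_sorted).
    by apply/allP=> x; rewrite (perm_mem perm_s) mem_iota add1n => /andP[].
  by apply: checkpoint_cat; have := cps _ _ _ s_eq; rewrite cats0; apply.
exists (W ++ c); split=> [| i /at_min[] | i /at_min[]] //.
rewrite /sorting_word (proj1 (final_stateE run_Wc)); congr (Some (State _ _ _ _)).
apply: (irr_sorted_eq ltn_trans ltnn o'_sorted (iota_ltn_sorted _ _)) => x.
have [_ _ _ perm_o' _] := run_invariants run_Wc.
by rewrite s_n -(perm_mem perm_s) -[s]cats0 (perm_mem perm_o').
Qed.
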